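(* Let $H$ be a Hilbert space and let $\mathcal{A}\subseteq\mathcal{B}(H)$ be a von Neumann algebra. Then $\mathcal{A}$ possesses property (V), that is, for all $x,y\in H$, $$\inf_{L\in \mathrm{Lat}\,\mathcal{A}} \left(\|(I-L)x\|^2 + \|Ly\|^2\right) \leq \|\omega_{x,y}|_{\mathcal{A}}\|.$$
   Context: $\mathcal{B}(H)$ is the algebra of all bounded linear operators on the Hilbert space $H$, with identity $I$. A projection is a self-adjoint idempotent in $\mathcal{B}(H)$. For a unital operator algebra $\mathcal{A}\subseteq\mathcal{B}(H)$ (von Neumann algebras on $H$ are understood to contain $I$), $\mathrm{Lat}\,\mathcal{A}$ denotes the set of all projections $L\in\mathcal{B}(H)$ with $(I-L)AL=0$ for all $A\in\mathcal{A}$. For $x,y\in H$, $\omega_{x,y}$ is the vector functional on $\mathcal{B}(H)$ given by $\omega_{x,y}(T)=(Tx,y)$, and $\omega_{x,y}|_{\mathcal{A}}$ is its restriction to $\mathcal{A}$; its norm is $\|\omega_{x,y}|_{\mathcal{A}}\|=\sup\{|(Ax,y)| : A\in\mathcal{A},\ \|A\|\le 1\}$. A unital operator algebra $\mathcal{A}\subseteq \mathcal{B}(H)$ is said to possess property (V) if the displayed inequality holds for all $x,y\in H$. *)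

(* Defs.v *)
From HB Require Import structures.
From mathcomp Require Import all_boot all_order all_algebra.
From mathcomp Require Import all_classical all_reals all_analysis.
From mathcomp.real_closed Require Import complex.

Set Implicit Arguments.
Unset Strict Implicit.
Unset Printing Implicit Defensive.

Import Order.TTheory GRing.Theory Num.Theory.
Import numFieldNormedType.Exports.

Local Open Scope classical_set_scope.
Local Open Scope complex_scope.
Local Open Scope ring_scope.

(* The inner product is linear in its first argument and conjugate-linear in
   the second one. Completeness is that of the normed module. *)
HB.mixin Record isHilbert (R : realType) H
    of CompleteNormedModule R[i] H := {
  hdot : {dot H for Num.conj} ;
  sqr_norm_hdot : forall x : H, `|x| ^+ 2 = hdot x x
}.

#[short(type="hilbertType")]
HB.structure Definition Hilbert (R : realType) :=
  {H of isHilbert R H & CompleteNormedModule R[i] H}.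

Arguments hdot {R s}.

(* Norms over [R[i]] take their (real) values in [R[i]]. *)
Definition rnorm (R : realType) (V : normedZmodType R[i]) (v : V) : R :=
  complex.Re `|v|.

Section Operators.
Variables (R : realType) (H : hilbertType R).
Implicit Types (A : set (H -> H)) (S T L : H -> H) (x y : H).

Definition bounded_operators : set (H -> H) :=
  [set T | linear T /\ exists M : R, forall x, rnorm (T x) <= M * rnorm x].

Definition opnorm T : R := sup [set rnorm (T x) | x in [set x | rnorm x <= 1]].

Definition is_adjoint T S : Prop := forall x y, hdot (T x) y = hdot x (S y).

Definition projections : set (H -> H) :=
  [set L | [/\ bounded_operators L, is_adjoint L L & L \o L = L]].

Record unital_operator_algebra A : Prop := UnitalOperatorAlgebra {
  alg_bounded : A `<=` bounded_operators ;
  alg_id : A idfun ;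
  alg_add : forall S T, A S -> A T -> A (S \+ T) ;
  alg_scale : forall (a : R[i]) T, A T -> A (a \*: T) ;
  alg_comp : forall S T, A S -> A T -> A (S \o T)
}.

(* The weak operator topology is the initial topology for the maps
   [T |-> hdot (T x) y]. It is put on all of [H -> H], so that closedness in
   the algebra of bounded operators is relative. *)
Definition matrix_coefficients T : {ptws H * H -> R[i]^o} :=
  fun xy => hdot (T xy.1) xy.2.

Definition wot : Type := initial_topology matrix_coefficients.

HB.instance Definition _ := Topological.on wot.

Definition wot_closed A : Prop :=
  bounded_operators `&` closure (A : set wot) `<=` A.

Record von_neumann_algebra A : Prop := VonNeumannAlgebra {
  vna_unital : unital_operator_algebra A ;
  vna_adjoint : forall T, A T -> exists2 S, A S & is_adjoint T S ;
  vna_closed : wot_closed A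
}.

Definition Lat A : set (H -> H) :=
  [set L | projections L /\
    forall T, A T -> (idfun \- L) \o T \o L = (fun=> 0)].

Definition vector_functional x y T : R[i] := hdot (T x) y.

Definition functional_norm A (w : (H -> H) -> R[i]) : R :=
  sup [set rnorm (w T) | T in [set T | A T /\ opnorm T <= 1]].

Definition property_V A : Prop := forall x y,
  inf [set rnorm ((idfun \- L) x) ^+ 2 + rnorm (L y) ^+ 2 | L in Lat A]
    <= functional_norm A (vector_functional x y).

End Operators.

(* Main.v *)
(* Write Re for the real part of the inner product. The norm [n] of the
   functional is attained, [n = Re (U x, y)], at a contraction [U] of [A] (weak
   compactness of the unit ball). Put [w = U' y], where [U'] is the adjoint of
   [U]. First-order optimality of [U] shows that [T |-> Re (T x, w)] is positive
   on [A] and that [(1 - U U') y] is orthogonal to [A x]. Hence [a x |-> a w] is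
   a positive symmetric operator on [A x]; if [h] is its Friedrichs extension,
   then the resolvent [E = (1 + h)^-1], extended by 0 off the closure of [A x],
   satisfies [0 <= E <= 1], commutes with [A] and maps [x + w] to [x], whence
   [((1 - E) x, x) + (E y, y) = n]. Now let [E] minimise
   [((1 - E) x, x) + (E y, y)] among all [0 <= E <= 1] commuting with [A]. Since
   [2E - E^2] is also a competitor, [E^2] is again minimal, and the powers
   [E^(2^k)] decrease to a minimising projection in [Lat A]. *)

Require Import Defs.
From mathcomp Require Import all_boot all_order all_algebra.
From mathcomp Require Import all_classical all_reals all_analysis.
From mathcomp Require Import ring lra.
From mathcomp.real_closed Require Import complex.

Set Implicit Arguments.
Unset Strict Implicit.
Unset Printing Implicit Defensive.

Import Order.TTheory GRing.Theory Num.Theory.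
Import numFieldNormedType.Exports.

Local Open Scope classical_set_scope.
Local Open Scope complex_scope.
Local Open Scope ring_scope.

(** * The real inner product *)

Lemma discriminant_le (R : realFieldType) (a b c : R) :
  (forall t, 0 <= a * t ^+ 2 + 2 * b * t + c) -> b ^+ 2 <= a * c.
Proof.
move=> ge0; have c0 : 0 <= c by have := ge0 0; rewrite expr0n !mulr0 !add0r.
have [a0|a0|a0] := ltgtP a 0.
(* At [t = u + 1 >= 1] one has [a * t < - (1 + c + 2 |b|)], so the quadratic falls below [-1]; hence
   [a < 0] is impossible. *)
- have := ge0 ((1 + c + 2 * `|b|) / - a + 1).
  set u := (_ / - a) => H; exfalso.
  have ua : a * u = - (1 + c + 2 * `|b|).
    by rewrite /u invrN mulrN mulrN mulrCA divff ?mulr1// lt_eqF.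
  have u0 : 0 <= u.
    rewrite /u mulr_ge0 ?invr_ge0 ?oppr_ge0 ?(ltW a0)//.
    by rewrite !addr_ge0 ?mulr_ge0.
  have := ler_norm b; move: H; nra.
- have := mulr_ge0 (ltW a0) (ge0 (- b / a)).
  have -> : a * (a * (- b / a) ^+ 2 + 2 * b * (- b / a) + c) = a * c - b ^+ 2.
    by field; rewrite gt_eqF.
  by rewrite subr_ge0.
- rewrite a0 mul0r; have [->|b0] := eqVneq b 0; first by rewrite expr0n.
  have := ge0 (- (c + 1) / b); rewrite a0 mul0r add0r.
  have -> : 2 * b * (- (c + 1) / b) = - 2 * (c + 1) by field.
  by move=> ?; exfalso; lra.
Qed.

Section RealInnerProduct.
Variables (R : realType) (H : hilbertType R).
Implicit Types (x y z : H) (t : R) (a : R[i]).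

Lemma hdotC x y : hdot x y = conjc (hdot y x).
Proof. by rewrite hermC expr0 mul1r. Qed.

Lemma hdotDl x y z : hdot (x + y) z = hdot x z + hdot y z.
Proof. exact: linearDl. Qed.

Lemma hdotZl a x y : hdot (a *: x) y = a * hdot x y.
Proof. exact: linearZl_LR. Qed.

Lemma hdotZr a x y : hdot x (a *: y) = conjc a * hdot x y.
Proof. exact: linearZr_LR. Qed.

Definition rdot x y : R := complex.Re (hdot x y).

Lemma rdotC x y : rdot x y = rdot y x.
Proof. by rewrite /rdot hdotC; case: (hdot y x). Qed.

Lemma rdotDl x y z : rdot (x + y) z = rdot x z + rdot y z.
Proof. by rewrite /rdot hdotDl; case: (hdot x z) (hdot y z) => ? ? []. Qed.

Lemma rdotDr x y z : rdot z (x + y) = rdot z x + rdot z y.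
Proof. by rewrite rdotC rdotDl ![rdot _ z]rdotC. Qed.

Lemma rdotZl t x y : rdot (t%:C *: x) y = t * rdot x y.
Proof. by rewrite /rdot hdotZl; case: (hdot x y) => [c d] /=; ring. Qed.

Lemma rdotZr t x y : rdot x (t%:C *: y) = t * rdot x y.
Proof. by rewrite rdotC rdotZl rdotC. Qed.

Lemma rdotNl x y : rdot (- x) y = - rdot x y.
Proof. by rewrite -scaleN1r -(rmorphN1 (real_complex R)) rdotZl mulN1r. Qed.

Lemma rdotNr x y : rdot x (- y) = - rdot x y.
Proof. by rewrite rdotC rdotNl rdotC. Qed.

Lemma rdotBl x y z : rdot (x - y) z = rdot x z - rdot y z.
Proof. by rewrite rdotDl rdotNl. Qed.

Lemma rdotBr x y z : rdot z (x - y) = rdot z x - rdot z y.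
Proof. by rewrite rdotDr rdotNr. Qed.

Lemma rdot0l y : rdot 0 y = 0.
Proof. by rewrite -(subrr y) rdotBl subrr. Qed.

Lemma rdot0r y : rdot y 0 = 0.
Proof. by rewrite rdotC rdot0l. Qed.

Definition rdotE :=
  (rdotDl, rdotDr, rdotNl, rdotNr, rdotZl, rdotZr, rdot0l, rdot0r).

Lemma rdot_conj a x y : rdot (a *: x) y = rdot x (conjc a *: y).
Proof.
rewrite /rdot hdotZl hdotZr.
by case: a (hdot x y) => [a b] [c d] /=; ring.
Qed.

(** Rotating the second argument recovers the imaginary part, so the real inner product [rdot] can
    carry the whole argument. *)
Lemma hdotE x y : hdot x y = rdot x y +i* rdot x ('i%C *: y).
Proof.
rewrite /rdot hdotZr; case: (hdot x y) => [c d] /=.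
by congr Complex; ring.
Qed.

Lemma rnorm_ge0 x : 0 <= rnorm x.
Proof.
have := normr_ge0 x; rewrite /rnorm; case: `|x| => c d.
by rewrite lecE /= => /andP[].
Qed.
Hint Resolve rnorm_ge0 : core.

Lemma norm_rnorm x : `|x| = (rnorm x)%:C.
Proof. by rewrite /rnorm RRe_real// ger0_real. Qed.

Lemma sqr_rnorm x : rnorm x ^+ 2 = rdot x x.
Proof. by rewrite /rdot -sqr_norm_hdot norm_rnorm -rmorphXn. Qed.

Lemma rdot_ge0 x : 0 <= rdot x x.
Proof. by rewrite -sqr_rnorm sqr_ge0. Qed.

Lemma rnorm0_eq0 x : rnorm x = 0 -> x = 0.
Proof. by move=> x0; apply/normr0_eq0; rewrite norm_rnorm x0. Qed.

Lemma ler_rnormD x y : rnorm (x + y) <= rnorm x + rnorm y.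
Proof. by have := ler_normD x y; rewrite !norm_rnorm -rmorphD lecR. Qed.

Lemma rnormN x : rnorm (- x) = rnorm x.
Proof. by rewrite /rnorm normrN. Qed.

Lemma rnormB x y : rnorm (x - y) = rnorm (y - x).
Proof. by rewrite -rnormN opprB. Qed.

Lemma rnormZ t x : rnorm (t%:C *: x) = `|t| * rnorm x.
Proof.
apply/eqP; rewrite -(@eqrXn2 _ 2)// ?mulr_ge0 ?rnorm_ge0//.
by rewrite exprMn !sqr_rnorm rdotZl rdotZr real_normK ?num_real// mulrA expr2.
Qed.

Lemma rdot_CS x y : `|rdot x y| <= rnorm x * rnorm y.
Proof.
rewrite -(@ler_pXn2r _ 2)// ?nnegrE ?mulr_ge0// real_normK ?num_real//.
rewrite exprMn mulrC !sqr_rnorm; apply: discriminant_le => t.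
have := rdot_ge0 (x + t%:C *: y); rewrite !rdotE (rdotC y x); lra.
Qed.

Lemma rdot_le x y : rdot x y <= rnorm x * rnorm y.
Proof. exact: le_trans (ler_norm _) (rdot_CS x y). Qed.

Lemma rdot_inj x y : (forall z, rdot x z = rdot y z) -> x = y.
Proof.
move=> xy; apply/eqP; rewrite -subr_eq0; apply/eqP/rnorm0_eq0/eqP.
by rewrite -sqrf_eq0 sqr_rnorm rdotBl xy subrr.
Qed.

End RealInnerProduct.
#[local] Hint Extern 0 (is_true (0 <= rnorm _)) => exact: rnorm_ge0 : core.

(** The restriction [d <= 1] lets errors quadratic in [d] be absorbed into the linear term
    [K * d]. *)
Lemma le_small (R : realFieldType) (u v K : R) :
  (forall d, 0 < d -> d <= 1 -> u <= v + K * d) -> u <= v.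
Proof.
move=> uv; apply/ler_addgt0Pr => e e0.
have [K0|K0] := ltP 0 K; last first.
  by have := uv _ ltr01 (lexx 1); lra.
have d0 : 0 < Num.min 1 (e / K) by rewrite lt_min ltr01 divr_gt0.
apply: le_trans (uv _ d0 _) _; first by rewrite ge_min lexx.
by rewrite lerD2l mulrC -ler_pdivlMr// ge_min lexx orbT.
Qed.

Lemma rnorm_small (R : realType) (H : hilbertType R) (z w : H) (K : R) :
  (forall d, 0 < d -> rnorm (z - w) <= K * d) -> z = w.
Proof.
move=> zw; apply/eqP; rewrite -subr_eq0; apply/eqP/rnorm0_eq0/eqP.
rewrite eq_le rnorm_ge0 andbT; apply: (@le_small _ _ _ K) => d d0 _.
by rewrite add0r zw.
Qed.

(** * Approximate Riesz representation and completeness *)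

(** A near-minimiser [v] of [J v = q v v - 2 g v] works: along each line [v + t b] the value of [J]
    drops by less than [d ^+ 2] below [J v], and the discriminant of this quadratic in [t] gives the
    estimate. As [S] may be incomplete for [q], the representation is only approximate. *)
Lemma approx_riesz (R : realType) (V : lmodType R[i]) (S : set V)
    (q : V -> V -> R) (g : V -> R) (C : R) :
  S 0 ->
  (forall u v (t : R), S u -> S v -> S (u + t%:C *: v)) ->
  (forall u v (t : R), S u -> S v -> q (u + t%:C *: v) (u + t%:C *: v) =
     q u u + 2 * q u v * t + q v v * t ^+ 2) ->
  (forall u v (t : R), S u -> S v -> g (u + t%:C *: v) = g u + t * g v) ->
  0 <= C ->
  (forall v, S v -> 0 <= q v v) ->
  (forall v, S v -> g v ^+ 2 <= C * q v v) ->
  forall d, 0 < d ->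
    exists2 v, S v & forall b, S b -> (q v b - g b) ^+ 2 <= d ^+ 2 * q b b.
Proof.
move=> S0 SD qD gD C0 q0 gC d d0.
pose J v := q v v - 2 * g v; pose E := [set J v | v in S].
have lbE : lbound E (- C).
  move=> _ [v Sv <-]; rewrite /J.
  have qv := q0 _ Sv.
  (* Here [4 (g v)^2 <= 4 C (q v v) <= (q v v + C)^2]. *)
  have : `|2 * g v| <= q v v + C.
    rewrite -(@ler_pXn2r _ 2)// ?nnegrE ?addr_ge0// real_normK ?num_real//.
    have := gC _ Sv; have := sqr_ge0 (q v v - C); lra.
  by move=> /(le_trans (ler_norm _)); lra.
have hE : has_inf E by split; [exists (J 0), 0 | exists (- C)].
have [_ [v Sv <-] Jv] := inf_adherent (exprn_gt0 2 d0) hE.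
exists v => // b Sb; rewrite mulrC; apply: discriminant_le => t.
have : inf E <= J (v + t%:C *: b).
  apply: ge_inf; first exact: hE.2.
  by exists (v + t%:C *: b) => //; exact: SD.
rewrite /J qD// gD// => Jt; move: Jv; rewrite /J; lra.
Qed.

Section Completeness.
Variables (R : realType) (H : hilbertType R).
Implicit Types (P : R -> set H) (d e : R).

(** [P d] stands for the approximate solutions with error [d]. Choosing elements of [P n.+1^-1]
    gives a Cauchy sequence, and passing to its limit lets [e] tend to 0 in the second
    hypothesis. *)
Lemma complete_approx P :
  (forall d, 0 < d -> P d !=set0) ->
  (forall d e v w, 0 < d -> 0 < e -> P d v -> P e w ->
     rnorm (v - w) <= d + e) ->
  exists z, forall d v, 0 < d -> P d v -> rnorm (v - z) <= d.
Proof.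
move=> exP closeP.
have n0 n : 0 < n.+1%:R^-1 :> R by rewrite invr_gt0.
have [u Pu] := choice (fun n => exP n.+1%:R^-1 (n0 n)).
have small (e : R) : 0 < e -> \forall n \near \oo, n.+1%:R^-1 < e.
  by move=> e0; exact: (near_infty_natSinv_lt (PosNum e0)).
have /cauchy_cvgP cu : cauchy (u @ \oo).
  apply: cauchy_exP => e e0.
  have eE : e = (complex.Re e)%:C by rewrite RRe_real// gtr0_real.
  have r0 : 0 < complex.Re e / 2 by rewrite divr_gt0// -ltcR -eE.
  have [N _ HN] := small _ r0; exists (u N); exists N => // n Nn.
  rewrite /= -ball_normE /= norm_rnorm eE ltcR.
  rewrite (le_lt_trans (closeP _ _ _ _ (n0 N) (n0 n) (Pu N) (Pu n)))//.
  by rewrite [ltRHS]splitr ltrD// HN/=.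
exists (lim (u @ \oo)) => d v d0 Pv; apply/ler_addgt0Pr => e e0.
have e20 : 0 < e / 2 by rewrite divr_gt0.
have e2C : 0 < (e / 2)%:C by rewrite ltcR.
near \oo => n.
have un : rnorm (u n - lim (u @ \oo)) <= e / 2.
  rewrite rnormB -lecR -norm_rnorm; near: n.
  by move/cvgrPdist_le: cu; apply.
have : rnorm (v - u n) <= d + n.+1%:R^-1 by exact: closeP.
have : n.+1%:R^-1 < e / 2 by near: n; exact: small.
have := ler_rnormD (v - u n) (u n - lim (u @ \oo)); rewrite addrA subrK.
by move: _^-1 => m; lra.
Unshelve. all: by end_near. Qed.

Lemma riesz (g : H -> R) (C : R) :
  (forall u v (t : R), g (u + t%:C *: v) = g u + t * g v) ->
  (forall v, `|g v| <= C * rnorm v) ->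
  exists z, forall v, rdot z v = g v.
Proof.
move=> gD gC.
pose P (d : R) (v : H) :=
  forall b, (rdot v b - g b) ^+ 2 <= d ^+ 2 * rdot b b.
have PE d v : 0 < d -> P d v -> forall b, `|rdot v b - g b| <= d * rnorm b.
  move=> d0 Pv b; rewrite -(@ler_pXn2r _ 2)// ?nnegrE ?mulr_ge0// ?(ltW d0)//.
  by rewrite real_normK ?num_real// exprMn sqr_rnorm.
have exP : forall d, 0 < d -> P d !=set0.
  move=> d dp; suff [v _ Pv] : exists2 v, setT v & forall b, setT b ->
    (rdot v b - g b) ^+ 2 <= d ^+ 2 * rdot b b by exists v => b; exact: Pv.
  apply: (@approx_riesz _ _ _ _ _ (C ^+ 2)) => //.
  - by move=> u v t _ _; rewrite !rdotE (rdotC v u); ring.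
  - exact: sqr_ge0.
  - by move=> v _; exact: rdot_ge0.
  - move=> v _; rewrite -sqr_rnorm -exprMn -[leLHS]real_normK ?num_real//.
    by rewrite ler_pXn2r// nnegrE//; exact: le_trans (gC v).
have [|z Pz] := complete_approx exP.
  (* Testing both approximations at [v - w] gives [|v - w|^2 <= (d + e) |v - w|]. *)
  move=> d e v w d0 e0 Pv Pw.
  have [->|vw0] := eqVneq (rnorm (v - w)) 0; first by rewrite addr_ge0// ltW.
  have {}vw0 : 0 < rnorm (v - w) by rewrite lt_def vw0/=.
  rewrite -(ler_pM2r vw0) -expr2 sqr_rnorm rdotBl.
  have := le_trans (ler_norm _) (PE _ _ d0 Pv (v - w)).
  have := le_trans (ler_norm _) (PE _ _ e0 Pw (w - v)).
  rewrite (rnormB w v) !rdotBr.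
  have -> : g (v - w) = g v - g w.
    by rewrite -[- w]scaleN1r -(rmorphN1 (real_complex R)) gD mulN1r.
  have -> : g (w - v) = g w - g v.
    by rewrite -[- v]scaleN1r -(rmorphN1 (real_complex R)) gD mulN1r.
  lra.
exists z => b; apply/eqP; rewrite -subr_eq0 -normr_le0.
apply/ler_addgt0Pr => e e0; rewrite add0r.
have K0 : 0 < 2 * rnorm b + 1 by rewrite ltr_wpDl// mulr_ge0.
pose d := e / (2 * rnorm b + 1).
have d0 : 0 < d by rewrite divr_gt0.
have [v Pv] := exP d d0.
have zv : `|rdot (z - v) b| <= d * rnorm b.
  apply: le_trans (rdot_CS _ _) _; rewrite ler_wpM2r// rnormB; exact: Pz.
have := PE _ _ d0 Pv b.
have : d * (2 * rnorm b + 1) = e by rewrite /d divfK// gt_eqF.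
have := ler_normD (rdot (z - v) b) (rdot v b - g b).
rewrite rdotBl addrA subrK; move: zv; rewrite rdotBl; lra.
Qed.

End Completeness.

(** * Weak operator compactness *)

Lemma fmap_ultra (T U : Type) (f : T -> U) (F : set_system T) :
  UltraFilter F -> UltraFilter (f @ F).
Proof.
move=> UF; split=> [|G PG FG]; first exact: fmap_proper_filter.
apply/seteqP; split=> // A GA.
have [//|FnA] := in_ultra_setVsetC (f @^-1` A) UF.
have : G (~` A) by exact: FG.
by move=> /(filterI GA)/filter_ex[u []].
Qed.

Section WeakLimits.
Variables (R : realType) (H : hilbertType R).
Implicit Types (S T : H -> H) (F : set_system (H -> H)).

(** Weak operator convergence along [F]: imaginary parts are covered by replacing [y] with
    ['i *: y]. *)
Definition weak_limit F T :=
  forall x y, rdot (S x) y @[S --> F] --> rdot (T x) y.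

Definition contractions : set (H -> H) :=
  [set S | linear S /\ forall x, rnorm (S x) <= rnorm x].

(** Weak compactness of the unit ball: along an ultrafilter each coefficient converges inside a
    compact interval, and the limiting form [B] is represented by an operator through [riesz]. *)
Lemma contraction_cluster F : UltraFilter F -> F contractions ->
  exists2 T, contractions T & weak_limit F T.
Proof.
move=> UF FC.
have exB (xy : H * H) : exists l : R,
    `|l| <= rnorm xy.1 * rnorm xy.2 /\ rdot (S xy.1) xy.2 @[S --> F] --> l.
  case: xy => x y /=; pose c := rnorm x * rnorm y.
  have := @segment_compact R (- c) c; rewrite compact_ultra => cptc.
  have [|l [/=]] := cptc (rdot (S x) y @[S --> F]) (fmap_ultra _ UF).
    apply: (filterS _ (FC : nbhs F contractions)) => S [_ Sx].
    rewrite /= in_itv/= -ler_norml.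
    by rewrite (le_trans (rdot_CS _ _))// ler_wpM2r.
  by rewrite in_itv/= -ler_norml => lc Fl; exists l.
have [B HB] := choice exB.
have uniq (f g : (H -> H) -> R) (l m : R) : (forall S, contractions S -> f S = g S) ->
    f S @[S --> F] --> l -> g S @[S --> F] --> m -> l = m.
  move=> fg fl gm. apply: norm_cvg_unique gm; apply: cvg_trans fl.
  by apply: near_eq_cvg; apply: (filterS _ (FC : nbhs F contractions)) => S /fg.
have exT x : exists z, forall y, rdot z y = B (x, y).
  apply: (@riesz _ _ (fun y => B (x, y)) (rnorm x)) => [u v t|v]; last exact: (HB (x, v)).1.
  apply: (uniq _ _ _ _ _ (HB (x, _)).2
    (cvgD (HB (x, u)).2 (cvgMl_tmp (a := t) (HB (x, v)).2))) => S _ /=.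
  by rewrite !rdotE.
have [T HT] := choice exT.
have FT : weak_limit F T by move=> x y; rewrite HT; exact: (HB (x, y)).2.
exists T => //; split=> [a x y|x].
  (* [rdot] is only real-bilinear, so a complex scalar is moved to the other argument as its
     conjugate before the limit is taken. *)
  apply: rdot_inj => z; rewrite rdotDl rdot_conj.
  apply: (uniq _ _ _ _ _ (FT _ z) (cvgD (FT x _) (FT y z))) => S [linS _] /=.
  by rewrite linS rdotDl rdot_conj.
have [->//|Tx0] := eqVneq (rnorm (T x)) 0.
rewrite -(@ler_pM2r _ (rnorm (T x))) ?lt_def ?Tx0//= -expr2 sqr_rnorm HT.
exact: le_trans (ler_norm _) (HB (x, T x)).1.
Qed.

Lemma weak_limit_wot_closed (A : set (H -> H)) F T : ProperFilter F ->
  F A -> weak_limit F T -> wot_closed A -> bounded_operators T -> A T.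
Proof.
move=> PF FA FT clA bT; apply: clA; split=> // B.
rewrite /= nbhsE => -[_ [[D oD <-] DT] DB].
have cvgF : (@matrix_coefficients R H) @ F --> matrix_coefficients T.
  apply/pointwise_cvgP => -[x y].
  apply/cvgrPdist_lt => e e0.
  have eE : e = (complex.Re e)%:C by rewrite RRe_real// gtr0_real.
  have r0 : 0 < complex.Re e / 2 by rewrite divr_gt0// -ltcR -eE.
  (* Real and imaginary parts each within half the radius keep the modulus below the radius. *)
  have /cvgrPdist_lt/(_ _ r0) := FT x y.
  have /cvgrPdist_lt/(_ _ r0) := FT x ('i%C *: y).
  apply: filterS2 => S /= Si Sr; rewrite /matrix_coefficients/= !hdotE.
  rewrite normc_def eE ltcR /= -[ltRHS]ger0_norm; last by rewrite -lecR -eE ltW.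
  rewrite -sqrtr_sqr ltr_sqrt ?exprn_gt0//; last by rewrite -ltcR -eE.
  move: Sr Si => /ltr_normlP[? ?] /ltr_normlP[? ?]; nra.
have : F (A `&` (@matrix_coefficients R H) @^-1` D).
  apply: filterI => //; apply: cvgF; exact: open_nbhs_nbhs.
by move=> /filter_ex [S [AS DS]]; exists S; split => //; exact: DB.
Qed.

(** The sets where [f] is within [e] of its supremum over [K] generate a filter, and an ultrafilter
    refining it has a weak limit [T]. [F] is returned along with [T] so that closedness of [K] can
    be applied afterwards. *)
Lemma weak_max (K : set (H -> H)) (f : (H -> H) -> R) (M : R) :
  K !=set0 -> K `<=` contractions -> (forall S, K S -> f S <= M) ->
  (forall F T, ProperFilter F -> weak_limit F T -> f S @[S --> F] --> f T) ->
  exists F T, [/\ ProperFilter F, F K, contractions T, weak_limit F T &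
    forall S, K S -> f S <= f T].
Proof.
move=> [S0 KS0] KC fM fcont; pose s := sup (f @` K).
have hs : has_sup (f @` K).
  by split; [exists (f S0), S0 | exists M => _ [S /fM ? <-]].
pose G : set_system (H -> H) :=
  filter_from [set e : R | 0 < e] (fun e => [set S | K S /\ s - e < f S]).
have PG : ProperFilter G.
  apply: filter_from_proper; last first.
    move=> e e0; have [_ [S KS <-] fS] := sup_adherent e0 hs.
    by exists S.
  apply: filter_from_filter; first by exists 1; exact: ltr01.
  move=> d e d0 e0; exists (Num.min d e); first by rewrite /= lt_min d0.
  have [de|ed] := leP d e => S [KS fS]; split; split => //=; lra.
have [F [UF GF]] := ultraFilterLemma PG.
have FS e : 0 < e -> F [set S | K S /\ s - e < f S].
  by move=> e0; apply: GF; exists e.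
have FK : F K by apply: filterS (FS 1 ltr01) => S [].
have [T CT FT] := contraction_cluster UF (filterS KC FK).
have PF : ProperFilter F by exact: ultra_proper.
exists F, T; split => // S KS; apply: (@le_trans _ _ s).
  by apply: sup_upper_bound => //; exists S.
apply/ler_addgt0Pr => e e0; have e20 : 0 < e / 2 by rewrite divr_gt0.
have /cvgrPdist_lt fT := fcont F T PF FT.
move: (fT _ e20) => /(filterI (FS _ e20))/filter_ex[S1 /= [[_ s1] /ltr_normlP[]]]; lra.
Qed.

End WeakLimits.
Arguments contractions {R H} _.

(** * Effects of the commutant *)

Section Effects.
Variables (R : realType) (H : hilbertType R).
Implicit Types (S T E : H -> H) (F : set_system (H -> H)) (A : set (H -> H)).

Lemma linear_addE T : linear T -> forall x y, T (x + y) = T x + T y.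
Proof. by move=> linT x y; rewrite -[x]scale1r linT !scale1r. Qed.

Lemma linear_0E T : linear T -> T 0 = 0.
Proof.
move=> /linear_addE/(_ 0 0); rewrite addr0 => /(congr1 (fun z => z - T 0)).
by rewrite subrr addrK.
Qed.

Lemma linear_scaleE T : linear T -> forall a x, T (a *: x) = a *: T x.
Proof.
by move=> linT a x; rewrite -[a *: x]addr0 linT linear_0E// addr0.
Qed.

Lemma linear_subE T : linear T -> forall x y, T (x - y) = T x - T y.
Proof.
by move=> linT x y; rewrite linear_addE// -scaleN1r linear_scaleE// scaleN1r.
Qed.

Lemma rdot_adjoint T S : is_adjoint T S ->
  forall x y, rdot (T x) y = rdot x (S y).
Proof. by move=> TS x y; rewrite /rdot TS. Qed.

Lemma bounded_gt0 T : bounded_operators T ->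
  exists2 K : R, 0 < K & forall x, rnorm (T x) <= K * rnorm x.
Proof.
move=> [_ [M TM]]; exists (`|M| + 1); first by rewrite ltr_wpDl.
move=> x; apply: le_trans (TM x) _; rewrite ler_wpM2r//.
by rewrite (le_trans (ler_norm M))// lerDl.
Qed.

Lemma le_of_cvg (X : Type) (F : set_system X) (D : set X) (f g : X -> R)
    (l m : R) : ProperFilter F -> F D -> (forall u, D u -> f u <= g u) ->
  f u @[u --> F] --> l -> g u @[u --> F] --> m -> l <= m.
Proof.
move=> PF FD fg fl gm; rewrite -subr_ge0.
apply: (@closed_cvg _ _ _ _ (g \- f) (fun z => 0 <= z) _ _ _ (cvgB gm fl)).
  exact: closed_ge.
by apply: (filterS _ (FD : nbhs F D)) => u /fg; rewrite /= subr_ge0.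
Qed.

Lemma eq_of_cvg (X : Type) (F : set_system X) (D : set X) (f g : X -> R)
    (l m : R) : ProperFilter F -> F D -> (forall u, D u -> f u = g u) ->
  f u @[u --> F] --> l -> g u @[u --> F] --> m -> l = m.
Proof.
move=> PF FD fg fl gm; apply/eqP; rewrite eq_le; apply/andP; split.
- by apply: (le_of_cvg PF FD _ fl gm) => u /fg ->.
- by apply: (le_of_cvg PF FD _ gm fl) => u /fg ->.
Qed.

Definition sym T := forall x y, rdot (T x) y = rdot x (T y).

(** [K T (K - T) = (K - T) T (K - T) + T (K - T) T], and both summands are positive. *)
Lemma sym_le_norm T (K : R) : linear T -> sym T ->
  0 < K -> (forall x, 0 <= rdot (T x) x <= K * rdot x x) ->
  forall x, rdot (T x) (T x) <= K * rdot (T x) x.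
Proof.
move=> linT symT K0 posT x.
have /andP[_ h1] := posT (T x).
have /andP[h2 _] := posT (K%:C *: x - T x).
move: h2; rewrite (linear_subE linT) (linear_scaleE linT) !rdotE [rdot (T (T x)) x]symT => h2.
rewrite -(ler_pM2l K0); lra.
Qed.

(** The positive contractions in the commutant of [A]; linearity is a consequence,
    [effect_linear]. *)
Definition effect A E := [/\ sym E, forall x, 0 <= rdot (E x) x <= rdot x x &
  forall T x, A T -> E (T x) = T (E x)].

Variable A : set (H -> H).
Hypotheses (unA : unital_operator_algebra A)
  (adjA : forall T, A T -> exists2 S, A S & is_adjoint T S).

Let A_lin T : A T -> linear T.
Proof. by move=> /(alg_bounded unA)[]. Qed.

Let A_scalar (a : R[i]) : A (fun x => a *: x).
Proof. exact: (alg_scale unA a (alg_id unA)). Qed.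

(** Symmetry gives real linearity; complex scalars belong to [A], so commutation covers them. *)
Lemma effect_linear E : effect A E -> linear E.
Proof.
move=> [symE _ comE] a x y; apply: rdot_inj => z.
rewrite symE !rdotDl !rdot_conj -symE !symE.
by rewrite (comE _ z (A_scalar _)).
Qed.

Lemma effect_sqr_le E : effect A E ->
  forall x, rdot (E x) (E x) <= rdot (E x) x.
Proof.
move=> eE x; have linE := effect_linear eE; case: eE => symE posE _.
rewrite -[leRHS]mul1r; apply: sym_le_norm => // y.
by rewrite mul1r.
Qed.

Lemma effect_contraction E : effect A E -> contractions E.
Proof.
move=> eE; split; first exact: effect_linear.
move=> x; rewrite -(@ler_pXn2r _ 2)// ?nnegrE// !sqr_rnorm.
apply: le_trans (effect_sqr_le eE x) _.
by case: eE => _ /(_ x)/andP[].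
Qed.

Lemma effect_compl E : effect A E -> effect A (idfun \- E).
Proof.
move=> [symE posE comE]; split=> [x y|x|T x AT] /=.
- by rewrite /= !rdotE symE.
- by have := posE x; rewrite /= !rdotE; lra.
- by rewrite (linear_subE (A_lin AT)) (comE T _ AT).
Qed.

Lemma effect_sqr E : effect A E -> effect A (E \o E).
Proof.
move=> eE; have := effect_sqr_le eE; case: eE => symE posE comE le2.
split=> [x y|x|T x AT] /=.
- by rewrite !symE.
- rewrite symE rdot_ge0/= (le_trans (le2 x))//.
  by have /andP[] := posE x.
- by rewrite !(comE T _ AT).
Qed.

(** Each defining condition compares matrix coefficients and so passes to the limit; for
    commutation, the adjoint of [T] turns [T (S x)] into a coefficient of [S]. *)
Lemma weak_limit_effect F E : ProperFilter F -> F (effect A) ->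
  weak_limit F E -> effect A E.
Proof.
move=> PF Fe FE; split=> [x y|x|T x AT].
- rewrite [RHS]rdotC; apply: (eq_of_cvg PF Fe _ (FE x y) (FE y x)) => S [sS _ _].
  by rewrite sS rdotC.
- apply/andP; split.
    apply: (le_of_cvg PF Fe _ (cvg_cst 0) (FE x x)) => S [_ + _].
    by move=> /(_ x)/andP[].
  apply: (le_of_cvg PF Fe _ (FE x x) (cvg_cst _)) => S [_ + _].
  by move=> /(_ x)/andP[].
- have [T' AT' TT'] := adjA AT.
  apply: rdot_inj => y; rewrite (rdot_adjoint TT').
  apply: (eq_of_cvg PF Fe _ (FE (T x) y) (FE x (T' y))) => S [_ _ comS].
  by rewrite (comS T _ AT) (rdot_adjoint TT').
Qed.

(** * Strong convergence of the powers of an effect *)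

Section Powers.
Variables (E : H -> H) (eE : effect A E).
Let symE : sym E := let: And3 s _ _ := eE in s.

Let sym_iter m n x y :
  rdot (iter m E x) (iter n E y) = rdot (iter (m + n) E x) y.
Proof.
elim: n m => [|n IH] m; first by rewrite addn0.
by rewrite iterS -symE -iterS IH addSnnS.
Qed.

Let c n x := rdot (iter n E x) x.

(** With [u = E^(n./2) x], the moment is [|u|^2] for even [n] and [(E u, u)] for odd [n]; positivity
    and monotonicity of [c] reduce to inequalities for [E] at [u]. *)
Let iter_halfE n x : c n x =
  rdot (iter (uphalf n) E x) (iter n./2 E x).
Proof. by rewrite sym_iter uphalf_half -addnA addnn odd_double_half. Qed.

Let c_ge0 n x : 0 <= c n x.
Proof.
have [_ posE _] := eE.
rewrite iter_halfE uphalf_half; case: odd => /=; last exact: rdot_ge0.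
by have /andP[] := posE (iter n./2 E x).
Qed.

Let c_leS n x : c n.+1 x <= c n x.
Proof.
have [_ posE _] := eE.
rewrite !iter_halfE /= uphalf_half; case: odd => /=; rewrite ?add1n ?add0n/=.
  exact: effect_sqr_le.
by have /andP[] := posE (iter n./2 E x).
Qed.

Let c_le m n x : (m <= n)%N -> c n x <= c m x.
Proof.
move=> /subnK <-; elim: (n - m)%N => // k IH.
by rewrite addSn (le_trans (c_leS _ _)).
Qed.

Lemma effect_iter n : effect A (iter n E).
Proof.
have [_ _ comE] := eE; split=> [x y|x|T x AT].
- by rewrite -[X in rdot X (iter n E y)]/(iter 0 E x) sym_iter.
- by rewrite c_ge0 (c_le _ (leq0n n)).
- by elim: n => //= n ->; rewrite (comE T _ AT).
Qed.

(** The moments [c] decrease to [l], and [|E^n x - E^m x|^2 = c (2n) - 2 c (n + m) + c (2m)], so the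
    powers are Cauchy at [x]. *)
Lemma effect_iter_cvg x :
  exists z, forall d : R, 0 < d ->
    \forall n \near \oo, rnorm (iter n E x - z) <= d.
Proof.
pose l := inf (range (c ^~ x)).
have hl : has_inf (range (c ^~ x)).
  by split; [exists (c 0 x), 0%N | exists 0 => _ [n _ <-]].
have l_le n : l <= c n x by apply: ge_inf; [exact: hl.2|exists n].
pose P (d : R) := [set z | exists2 n, z = iter n E x & c (n + n) x <= l + d ^+ 2].
have nearP d : 0 < d -> \forall n \near \oo, P d (iter n E x).
  move=> d0; have [_ [N _ <-] cN] := inf_adherent (exprn_gt0 2 d0) hl.
  exists N => // n /= Nn; exists n => //.
  by rewrite (le_trans _ (ltW cN))// c_le// (leq_trans Nn)// leq_addr.
have [d d0|d e v w d0 e0 [n -> cn] [m -> cm]|z Pz] := @complete_approx R H P.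
- have [N _ HN] := nearP d d0; exists (iter N E x); exact: HN (leqnn N).
- rewrite -(@ler_pXn2r _ 2)// ?nnegrE ?addr_ge0// ?(ltW d0) ?(ltW e0)//.
  rewrite sqr_rnorm !rdotE ![rdot (iter _ E x) (iter _ E x)]sym_iter.
  rewrite -!/(c _ x) (addnC m n).
  have := l_le (n + m)%N; move: (mulr_gt0 d0 e0); lra.
- exists z => d d0; apply: filterS (nearP d d0) => n; exact: Pz.
Qed.

End Powers.
End Effects.

(** * From a maximising effect to an invariant projection *)

Section ProjectionOfEffect.
Variables (R : realType) (H : hilbertType R) (A : set (H -> H)).
Hypotheses (unA : unital_operator_algebra A)
  (adjA : forall T, A T -> exists2 S, A S & is_adjoint T S).
Variables x y : H.

(** [|x|^2 - effect_gap E] is [((1 - E) x, x) + (E y, y)], so minimising the latter means maximising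
    the gap. *)
Definition effect_gap (E : H -> H) := rdot (E x) x - rdot (E y) y.

Lemma effect_gap_cvg F E : ProperFilter F -> weak_limit F E ->
  effect_gap S @[S --> F] --> effect_gap E.
Proof. by move=> PF FE; exact: cvgB (FE x x) (FE y y). Qed.

Lemma effect_id : effect A idfun.
Proof. by split=> // z; rewrite rdot_ge0 lexx. Qed.

Lemma effect_gap_max :
  exists2 E, effect A E & forall S, effect A S -> effect_gap S <= effect_gap E.
Proof.
have [||S [_ posS _]|F T PF|F [T [PF FK _ FT Tmax]]] :=
  @weak_max R H (effect A) effect_gap (rdot x x).
- by exists idfun; exact: effect_id.
- by move=> S; exact: effect_contraction.
- have /andP[_ xx] := posS x; have /andP[yy _] := posS y.
  by rewrite /effect_gap; lra.
- exact: effect_gap_cvg.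
- exists T => //; exact: weak_limit_effect FT.
Qed.

(* [2E - E^2 = 1 - (1 - E)^2] is again an effect, so [E^2] is maximal as well;
   the powers [E^(2^k)] decrease to a projection. *)
Lemma effect_gap_sqr E : effect A E ->
  (forall S, effect A S -> effect_gap S <= effect_gap E) ->
  effect_gap E <= effect_gap (E \o E).
Proof.
move=> eE Emax; have linE := effect_linear unA eE.
have eC := effect_compl unA (effect_sqr unA (effect_compl unA eE)).
have := Emax _ eC; rewrite /effect_gap /= !(linear_subE linE) !rdotE; lra.
Qed.

(** The strong limit [L] of all powers of [E] is the projection onto the fixed vectors of [E]. The
    gap is controlled along the exponents [2 ^ k] and compared with that of [L] in the limit. *)
Lemma effect_gap_projection E : effect A E ->
  (forall S, effect A S -> effect_gap S <= effect_gap E) ->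
  exists2 L, Lat A L & effect_gap E <= effect_gap L.
Proof.
move=> eE Emax.
have [L HL] := choice (effect_iter_cvg unA eE).
have eI n := effect_iter unA eE n.
have EL : weak_limit ((fun n => iter n E) @ \oo) L.
  move=> z w; apply/cvgrPdist_le => e e0.
  have K0 : 0 < rnorm w + 1 by rewrite ltr_wpDl.
  have d0 : 0 < e / (rnorm w + 1) by rewrite divr_gt0.
  apply: filterS (HL z _ d0) => n /= nz.
  rewrite -rdotBl (le_trans (rdot_CS _ _))// rnormB.
  rewrite (le_trans (ler_wpM2r (rnorm_ge0 w) nz))//.
  rewrite -[leRHS](divfK (lt0r_neq0 K0)) ler_wpM2l ?(ltW d0)//.
  by rewrite lerDl.
have eL : effect A L.
  apply: (weak_limit_effect adjA _ _ EL).
  by exists 0%N => // n _; exact: eI.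
have linL := effect_linear unA eL; have linE := effect_linear unA eE.
have [_ cE] := effect_contraction unA eE.
have [_ cL] := effect_contraction unA eL.
(* [E^(n+1) z] is close both to [L z] and to [E (L z)]. *)
have ELz z : E (L z) = L z.
  apply: (@rnorm_small _ _ _ _ 1) => d d0; rewrite mul1r; have d20 : 0 < d / 2 by rewrite divr_gt0.
  have [N _ HN] := HL z _ d20.
  have := HN N (leqnn N); have := HN N.+1 (leqnSn N) => /= h1 h2.
  have h3 : rnorm (E (L z) - E (iter N E z)) <= rnorm (iter N E z - L z).
    by rewrite -(linear_subE linE) (rnormB (iter N E z)).
  have := ler_rnormD (E (L z) - E (iter N E z)) (E (iter N E z) - L z).
  by rewrite addrA subrK; lra.
have ILz n z : iter n E (L z) = L z by elim: n => //= n ->.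
have LL z : L (L z) = L z.
  apply/esym/(@rnorm_small _ _ _ _ 1) => d d0; rewrite mul1r; have [N _ HN] := HL (L z) _ d0.
  by have := HN N (leqnn N); rewrite /= ILz.
have [symL _ comL] := eL.
exists L.
  split=> [|T AT]; last first.
    (* Commutation gives [L T L = T L L = T L]. *)
    by apply/funext => z /=; rewrite -(comL T _ AT) LL subrr.
  split.
  - by split => //; exists 1 => z; rewrite mul1r.
  - by move=> z w; rewrite !hdotE symL symL (linear_scaleE linL).
  - by apply/funext => z /=.
have gap_pow k : effect_gap E <= effect_gap (iter (2 ^ k) E).
  elim: k => // k IH; apply: le_trans (IH) _.
  have IE : iter (2 ^ k.+1) E = iter (2 ^ k) E \o iter (2 ^ k) E.
    by apply/funext => z /=; rewrite -iterD addnn -mul2n -expnS.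
  (* By the induction hypothesis [E^(2^k)] is itself maximal, so it may be squared once more. *)
  rewrite IE; apply: effect_gap_sqr => // S /Emax SE.
  exact: le_trans SE IH.
apply/ler_addgt0Pr => e e0.
have PF : ProperFilter ((fun n => iter n E) @ \oo) by exact: fmap_proper_filter.
have /cvgrPdist_le/(_ _ e0) [N _ HN] := effect_gap_cvg PF EL.
have /= := HN (2 ^ N)%N (ltnW (ltn_expl _ _)).
by move=> /(_ isT)/ler_normlP[]; have := gap_pow N; lra.
Qed.

End ProjectionOfEffect.

(** * The Friedrichs resolvent *)

Section FriedrichsResolvent.
Variables (R : realType) (H : hilbertType R) (A : set (H -> H)).
Hypotheses (unA : unital_operator_algebra A)
  (adjA : forall T, A T -> exists2 S, A S & is_adjoint T S).
Variables x w : H.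
Hypotheses
  (pos_w : forall p, A p -> sym p -> (forall z, 0 <= rdot (p z) z) ->
     0 <= rdot (p x) w)
  (sym_w : forall a b, A a -> A b -> rdot (a x) (b w) = rdot (b x) (a w)).
Implicit Types (a b c T : H -> H) (z : H) (d : R).

Let A_lin T : A T -> linear T.
Proof. by move=> /(alg_bounded unA)[]. Qed.

Let A_comb a b (t : R[i]) : A a -> A b -> A (a + t *: b).
Proof.
move=> Aa Ab; rewrite -[X in A X]/(a \+ (t \*: b)).
exact (alg_add unA Aa (alg_scale unA t Ab)).
Qed.

Let A0 : A 0.
Proof.
suff -> : (0 : H -> H) = idfun + (-1) *: idfun.
  by apply: A_comb; exact: (alg_id unA).
by apply/funext => z /=; rewrite -[RHS]/(z + -1 *: z) scaleN1r subrr.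
Qed.

(** The form of [1 + h] at the vectors [a x] and [b x], pulled back to [A]; with operators as
    arguments, no unbounded operator has to be built. *)
Let q a b := rdot (a x) (b x) + rdot (a x) (b w).

(** [(a x, a w) = (a' a x, w)], and [pos_w] applies to [a' \o a]. This is [1 + h >= 1]. *)
Let q_lower a : A a -> rdot (a x) (a x) <= q a a.
Proof.
move=> Aa; have [a' Aa' aa'] := adjA Aa; rewrite lerDl.
have -> : rdot (a x) (a w) = rdot ((a' \o a) x) w.
  by rewrite rdotC (rdot_adjoint aa') rdotC.
have aE u v : rdot (a' (a u)) v = rdot (a u) (a v).
  by rewrite rdotC -(rdot_adjoint aa') rdotC.
apply: (pos_w (p := a' \o a)); first exact (alg_comp unA Aa' Aa).
- by move=> u v /=; rewrite aE rdotC -aE rdotC.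
- by move=> u /=; rewrite aE rdot_ge0.
Qed.

Let q_ge0 a : A a -> 0 <= q a a.
Proof. by move=> /q_lower; apply: le_trans; exact: rdot_ge0. Qed.

Let qn a := Num.sqrt (q a a).

Let sqr_qn a : A a -> qn a ^+ 2 = q a a.
Proof. by move=> /q_ge0; exact: sqr_sqrtr. Qed.

Let qn_ge0 a : 0 <= qn a.
Proof. exact: sqrtr_ge0. Qed.

Let rnorm_le_qn a : A a -> rnorm (a x) <= qn a.
Proof.
by move=> Aa; rewrite -(@ler_pXn2r _ 2)// ?nnegrE// sqr_qn// sqr_rnorm q_lower.
Qed.

(** The weak form of [(1 + h) (a x) = z], with error [d] measured in the dual of the form norm
    [qn]. *)
Definition approximates z d a :=
  A a /\ forall b, A b -> `|q a b - rdot z (b x)| <= d * qn b.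

Let exists_approx z d : 0 < d -> exists a, approximates z d a.
Proof.
move=> d0.
suff [a Aa Pa] : exists2 a, A a & forall b, A b ->
    (q a b - rdot z (b x)) ^+ 2 <= d ^+ 2 * q b b.
  exists a; split=> // b Ab; rewrite -(@ler_pXn2r _ 2)// ?nnegrE ?mulr_ge0//.
    by rewrite real_normK ?num_real// exprMn sqr_qn// Pa.
  exact: ltW.
apply: (@approx_riesz _ _ _ q (fun b => rdot z (b x)) (rnorm z ^+ 2)) => //.
- by move=> u v t; exact: A_comb.
- move=> u v t Au Av; rewrite /q.
  rewrite -!/(u x + t%:C *: v x) -!/(u w + t%:C *: v w) !rdotE.
  rewrite (rdotC (v x) (u x)) (sym_w Av Au); ring.
- by move=> u v t _ _; rewrite -!/(u x + t%:C *: v x) !rdotE.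
- exact: sqr_ge0.
- move=> v Av; rewrite (le_trans _ (ler_wpM2l (sqr_ge0 _) (q_lower Av)))//.
  rewrite -sqr_rnorm -exprMn -[leLHS]real_normK ?num_real//.
  by rewrite ler_pXn2r// ?nnegrE ?mulr_ge0// rdot_CS.
Qed.

(** Testing at the difference [c] gives [qn c <= d + e], and [qn] dominates the norm. *)
Let approx_close z d e a b : 0 < d -> 0 < e ->
  approximates z d a -> approximates z e b -> rnorm (a x - b x) <= d + e.
Proof.
move=> d0 e0 [Aa Pa] [Ab Pb].
have Ac := A_comb (-1) Aa Ab; set c := a + _ in Ac.
have cE u : c u = a u - b u by rewrite /c -[LHS]/(a u + -1 *: b u) scaleN1r.
rewrite -cE; apply: le_trans (rnorm_le_qn Ac) _.
have [->|c0] := eqVneq (qn c) 0; first by rewrite addr_ge0// ltW.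
have {}c0 : 0 < qn c by rewrite lt_def c0 qn_ge0.
rewrite -(ler_pM2r c0) -expr2 sqr_qn//.
have qB v : q c v = q a v - q b v by rewrite /q cE !rdotE; ring.
rewrite qB.
move: (Pa _ Ac) (Pb _ Ac) => /ler_normlP[_ ?] /ler_normlP[? _]; lra.
Qed.

Let exists_resolvent z : exists Ez, forall d a, 0 < d -> approximates z d a ->
  rnorm (a x - Ez) <= d.
Proof.
have [d d0|d e v u d0 e0 [a Pa <-] [b Pb <-]|Ez HE] :=
  @complete_approx R H (fun d => [set a x | a in approximates z d]).
- by have [a Pa] := exists_approx z d0; exists (a x), a.
- exact: approx_close Pa Pb.
- by exists Ez => d a d0 Pa; apply: HE => //; exists a.
Qed.

(** Obtained by testing the approximate equation at [a] itself; it keeps errors [d * qn a] of order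
    [d]. *)
Let approx_qn z d a : 0 < d -> approximates z d a -> qn a <= rnorm z + d.
Proof.
move=> d0 [Aa Pa]; have [->|a0] := eqVneq (qn a) 0.
  by rewrite addr_ge0// ltW.
have {}a0 : 0 < qn a by rewrite lt_def a0 qn_ge0.
rewrite -(ler_pM2r a0) -expr2 sqr_qn//.
have := rdot_le z (a x); have := ler_wpM2l (rnorm_ge0 z) (rnorm_le_qn Aa).
move: (Pa _ Aa) => /ler_normlP[_]; lra.
Qed.

(** [E z] is the limit of the vectors [a x] with [a] approximating [z]; each property of [E] is read
    off from approximants, up to an error that vanishes with [d]. *)
Lemma resolvent : exists2 E, effect A E & E (x + w) = x /\
  forall z, (forall b, A b -> rdot z (b x) = 0) -> E z = 0.
Proof.
have [E HE] := choice exists_resolvent.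
have EN z v d : rnorm (v - E z) <= d -> forall u,
    `|rdot v u - rdot (E z) u| <= d * rnorm u.
  move=> vE u; rewrite -rdotBl; apply: le_trans (rdot_CS _ _) _.
  exact: ler_wpM2r.
(* Both inner products are close to [q a b = q b a]: there are two resolvent errors and two form
   errors, the latter bounded by [approx_qn]. *)
have main z u d a b : 0 < d -> d <= 1 ->
    approximates z d a -> approximates u d b ->
  `|rdot (E z) u - rdot z (E u)| <= (2 * rnorm z + 2 * rnorm u + 2) * d.
  move=> d0 d1 Pa Pb.
  have := EN _ _ _ (HE _ _ _ d0 Pa) u; have := EN _ _ _ (HE _ _ _ d0 Pb) z.
  have := approx_qn d0 Pa; have := approx_qn d0 Pb.
  have [Aa qa] := Pa; have [Ab qb] := Pb.
  have := qa _ Ab; have := qb _ Aa.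
  have -> : q b a = q a b by rewrite /q rdotC (sym_w Ab Aa).
  rewrite [rdot (E u) z]rdotC [rdot (b x) z]rdotC [rdot (a x) u]rdotC.
  move=> /ler_normlP[h1 h2] /ler_normlP[h3 h4] h5 h6.
  move=> /ler_normlP[h7 h8] /ler_normlP[h9 h10].
  have h11 : d * qn a <= d * (rnorm z + d) by rewrite ler_wpM2l// ltW.
  have h12 : d * qn b <= d * (rnorm u + d) by rewrite ler_wpM2l// ltW.
  have h13 : d * d <= d by rewrite ger_pMr.
  by apply/ler_normlP; split; lra.
have symE : sym E.
  move=> z u; apply/eqP; rewrite -subr_eq0 -normr_le0.
  apply: (@le_small _ _ _ (2 * rnorm z + 2 * rnorm u + 2)) => d d0 d1.
  have [a Pa] := exists_approx z d0; have [b Pb] := exists_approx u d0.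
  by rewrite add0r; exact: main Pa Pb.
exists E; first split=> //.
- move=> z; apply/andP; split.
    (* [(E z, z)] is close to [(z, a x)], hence to [q a a >= 0]. *)
    apply: (@le_small _ _ _ (2 * rnorm z + 1)) => d d0 d1.
    have [a Pa] := exists_approx z d0; have := approx_qn d0 Pa.
    have := EN _ _ _ (HE _ _ _ d0 Pa) z; have [Aa /(_ _ Aa)] := Pa.
    rewrite [rdot (a x) z]rdotC.
    move=> /ler_normlP[h1 h2] /ler_normlP[h3 h4] h5.
    have h6 : d * qn a <= d * (rnorm z + d) by rewrite ler_wpM2l// ltW.
    have h7 : d * d <= d by rewrite ger_pMr.
    have := q_ge0 Aa; lra.
  (* From [|a x - z|^2 >= 0] and [q_lower], [2 (z, a x) <= |z|^2 + q a a], where [q a a] is close to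
     [(z, a x)]. *)
  apply: (@le_small _ _ _ (2 * rnorm z + 1)) => d d0 d1.
  have [a Pa] := exists_approx z d0; have := approx_qn d0 Pa.
  have := EN _ _ _ (HE _ _ _ d0 Pa) z; have [Aa /(_ _ Aa)] := Pa.
  rewrite [rdot (a x) z]rdotC.
  move=> /ler_normlP[h1 h2] /ler_normlP[h3 h4] h5.
  have h6 : d * qn a <= d * (rnorm z + d) by rewrite ler_wpM2l// ltW.
  have h7 : d * d <= d by rewrite ger_pMr.
  have := rdot_ge0 (a x - z); rewrite !rdotE (rdotC (a x) z).
  have := q_lower Aa; lra.
(* Since [q (T \o a) b = q a (T' \o b)] and [T'] has form norm at most [K], the operator [T \o a]
   approximates [T z] with error [K * d]. *)
- move=> T z AT; have [T' AT' TT'] := adjA AT.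
  have [K K0 HK] := bounded_gt0 (alg_bounded unA AT').
  have [M M0 HM] := bounded_gt0 (alg_bounded unA AT).
  have HK2 u : rdot (T' u) (T' u) <= K ^+ 2 * rdot u u.
    rewrite -!sqr_rnorm -exprMn lerXn2r// nnegrE//.
    by rewrite mulr_ge0// ltW.
  have T'x u v : rdot (T' u) v = rdot u (T v).
    by rewrite rdotC -(rdot_adjoint TT') rdotC.
  have qT' b : A b -> qn (T' \o b) <= K * qn b.
    move=> Ab; rewrite -(@ler_pXn2r _ 2)// ?nnegrE ?mulr_ge0 ?(ltW K0)//.
    have AT'b := alg_comp unA AT' Ab.
    rewrite exprMn !sqr_qn// /q mulrDr; apply: lerD.
      exact: HK2.
    have [b' Ab' bb'] := adjA Ab.
    have bE u v : rdot (b' u) v = rdot u (b v).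
      by rewrite rdotC -(rdot_adjoint bb') rdotC.
    (* Positivity of [p = b' (K^2 - T T') b] yields [(T' b x, T' b w) <= K^2 (b x, b w)]. *)
    pose p := b' \o (((K ^+ 2)%:C *: b : H -> H) + (-1) *: (T \o (T' \o b))).
    have pE u : p u = b' ((K ^+ 2)%:C *: b u - T (T' (b u))).
      rewrite -[LHS]/(b' ((K ^+ 2)%:C *: b u + -1 *: T (T' (b u)))).
      by rewrite scaleN1r.
    have : 0 <= rdot (p x) w.
      apply: (pos_w (p := p)).
      - exact (alg_comp unA Ab' (A_comb (-1)
          (alg_scale unA (K ^+ 2)%:C Ab) (alg_comp unA AT AT'b))).
      - move=> u v; rewrite !pE bE [RHS]rdotC bE !rdotE.
        by rewrite !(rdot_adjoint TT') !(rdotC _ (b u)) !(rdotC _ (T' (b u))).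
      - move=> u; rewrite pE bE !rdotE (rdot_adjoint TT') subr_ge0.
        exact: HK2.
    by rewrite pE bE !rdotE (rdot_adjoint TT') subr_ge0.
  apply: (@rnorm_small _ _ _ _ (K + M)) => d d0.
  have [a [Aa Pa]] := exists_approx z d0.
  have PTa : approximates (T z) (K * d) (T \o a).
    split=> [|b Ab]; first exact (alg_comp unA AT Aa).
    have -> : q (T \o a) b = q a (T' \o b).
      by rewrite /q/= !(rdot_adjoint TT').
    rewrite (rdot_adjoint TT') (mulrC K) -mulrA.
    apply: le_trans (Pa _ (alg_comp unA AT' Ab)) _.
    by rewrite ler_wpM2l ?(ltW d0)// qT'.
  have h1 := HE _ _ _ (mulr_gt0 K0 d0) PTa.
  have h2 := HE _ _ _ d0 (conj Aa Pa).
  have := le_trans (HM (a x - E z)) (ler_wpM2l (ltW M0) h2).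
  rewrite (linear_subE (A_lin AT)) => h3.
  have := ler_rnormD (E (T z) - T (a x)) (T (a x) - T (E z)).
  by rewrite addrA subrK; move: h1; rewrite /= rnormB; lra.
- split.
    (* [idfun] solves the equation for [x + w] exactly, since [q idfun b = (x + w, b x)] by [sym_w];
       below, 0 solves it for [z] orthogonal to [A x]. *)
    apply/esym/(@rnorm_small _ _ _ _ 1) => d d0; rewrite mul1r.
    apply: (HE _ _ idfun d0); split=> [|b Ab]; first exact: alg_id unA.
    have h : rdot x (b w) = rdot w (b x).
      by rewrite [RHS]rdotC; exact: (sym_w (alg_id unA) Ab).
    by rewrite /q /= rdotDl h subrr normr0 mulr_ge0// ltW.
  move=> z zA; apply/esym/(@rnorm_small _ _ _ _ 1) => d d0; rewrite mul1r.
  apply: (HE _ _ 0 d0); split=> // b Ab.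
  by rewrite zA// /q -![(0 : H -> H) x]/(0 : H) !rdot0l addr0 subrr normr0 mulr_ge0// ltW.
Qed.

End FriedrichsResolvent.

(** * First-order optimality of a norm-attaining contraction *)

(** The first-order condition at a maximum, from [discriminant_le] with constant term 0. *)
Lemma eq0_of_le_sqr (R : realFieldType) (u c : R) :
  (forall t, t * u <= t ^+ 2 * c) -> u = 0.
Proof.
move=> uc; have := @discriminant_le R c (- (u / 2)) 0.
rewrite mulr0 => /(_ _)/[!sqrrN] u0; apply/eqP; rewrite -sqrf_eq0.
have {}u0 : (u / 2) ^+ 2 <= 0 by apply: u0 => t; have := uc t; lra.
by rewrite eq_le sqr_ge0 andbT; lra.
Qed.

Section NormAttaining.
Variables (R : realType) (H : hilbertType R) (A : set (H -> H)).
Hypothesis vnA : von_neumann_algebra A.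
Variables x y : H.
Implicit Types (T : H -> H) (z : H).

Let unA := vna_unital vnA.
Let adjA := vna_adjoint vnA.

Let A_lin T : A T -> linear T.
Proof. by move=> /(alg_bounded unA)[]. Qed.

Let A_comb a b (t : R[i]) : A a -> A b -> A (fun z => a z + t *: b z).
Proof. by move=> Aa Ab; exact (alg_add unA Aa (alg_scale unA t Ab)). Qed.

Lemma norm_attained : exists U, [/\ A U, contractions U &
  forall T, A T -> contractions T -> rdot (T x) y <= rdot (U x) y].
Proof.
have [|T [_ //]|T [_ [_ CT]]|F T PF FT|F [U [PF FK CU FU Umax]]] :=
  @weak_max R H (A `&` contractions) (fun T => rdot (T x) y)
    (rnorm x * rnorm y).
- by exists idfun; split; [exact: (alg_id unA)|split].
- by rewrite (le_trans (rdot_le _ _))// ler_wpM2r.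
- exact: FT.
- exists U; split=> // [|T AT CT]; last by apply: Umax.
  (* Weak closedness brings the limit of the maximising filter back into [A]. *)
  apply: (weak_limit_wot_closed PF _ FU (vna_closed vnA)).
    by apply: (filterS _ (FK : nbhs F (A `&` contractions))) => T [].
  by split; [exact: CU.1|exists 1 => z; rewrite mul1r; exact: CU.2].
Qed.

Variables U U' : H -> H.
Hypotheses (AU : A U) (AU' : A U') (CU : contractions U)
  (UU' : is_adjoint U U')
  (Umax : forall T, A T -> contractions T -> rdot (T x) y <= rdot (U x) y).

Let n := rdot (U x) y.
Let w := U' y.

Let norm_le T (K : R) : A T -> 0 < K ->
  (forall z, rdot (T z) (T z) <= K ^+ 2 * rdot z z) -> rdot (T x) y <= K * n.
Proof.
move=> AT K0 TK; rewrite mulrC -ler_pdivrMr// mulrC -rdotZl.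
apply: (Umax (T := fun z => K^-1%:C *: T z)).
  exact (alg_scale unA _ AT).
split=> [a u v|z].
  rewrite (A_lin AT) scalerDr !scalerA; congr (_ *: _ + _).
  by rewrite mulrC.
rewrite -(@ler_pXn2r _ 2)// ?nnegrE// !sqr_rnorm !rdotE mulrA -expr2 exprVn.
by rewrite mulrC ler_pdivrMr ?exprn_gt0// mulrC.
Qed.

Let wE T : rdot (T x) w = rdot (U (T x)) y.
Proof. by rewrite (rdot_adjoint UU'). Qed.

Let norm_le_w T (K : R) : A T -> 0 < K ->
  (forall z, rdot (T z) (T z) <= K ^+ 2 * rdot z z) -> rdot (T x) w <= K * n.
Proof.
move=> AT K0 TK; rewrite wE; apply: (norm_le (T := U \o T)) => // [|z].
  exact (alg_comp unA AU AT).
apply: le_trans (TK z); rewrite -!sqr_rnorm lerXn2r ?nnegrE//.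
exact: CU.2.
Qed.

(** [K - p] lies between 0 and [K], so its norm is at most [K] and optimality gives
    [((K - p) x, w) <= K n = K (x, w)]. *)
Let pos_w p : A p -> sym p -> (forall z, 0 <= rdot (p z) z) ->
  0 <= rdot (p x) w.
Proof.
move=> Ap symp posp.
have [K K0 HK] := bounded_gt0 (alg_bounded unA Ap).
pose T z := K%:C *: z + -1 *: p z.
have TE z : T z = K%:C *: z - p z by rewrite /T scaleN1r.
have AT : A T.
  exact (A_comb (-1) (alg_scale unA K%:C (alg_id unA)) Ap).
have linT := A_lin AT.
have symT : sym T by move=> u v; rewrite !TE !rdotE symp.
have posT z : 0 <= rdot (T z) z <= K * rdot z z.
  rewrite TE !rdotE; have := rdot_le (p z) z.
  have := ler_wpM2r (rnorm_ge0 z) (HK z); rewrite -mulrA -expr2 sqr_rnorm.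
  by have := posp z; lra.
have := norm_le_w AT K0; rewrite TE !rdotE.
have -> : rdot x w = n by rewrite /w -(rdot_adjoint UU').
suff H0 z : rdot (T z) (T z) <= K ^+ 2 * rdot z z by move=> /(_ H0); lra.
have := sym_le_norm linT symT K0 posT z.
have /andP[_] := posT z => /(ler_wpM2l (ltW K0)); rewrite mulrA -expr2.
by move=> h1 h2; exact: le_trans h2 h1.
Qed.

(** The operator [k = b' a - a' b] is skew, so [|1 + t k|^2 <= 1 + t^2 K^2]; optimality then gives
    [t (k x, w) <= t^2 K^2 n] for every real [t]. *)
Let sym_w a b : A a -> A b -> rdot (a x) (b w) = rdot (b x) (a w).
Proof.
move=> Aa Ab; have [a' Aa' aa'] := adjA Aa; have [b' Ab' bb'] := adjA Ab.
pose k z := b' (a z) + -1 *: a' (b z).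
have Ak : A k by exact (A_comb (-1) (alg_comp unA Ab' Aa) (alg_comp unA Aa' Ab)).
have kE u v : rdot (k u) v = rdot (a u) (b v) - rdot (b u) (a v).
  rewrite /k scaleN1r rdotBl (rdotC (b' _)) (rdotC (a' _)).
  by rewrite -(rdot_adjoint aa') -(rdot_adjoint bb') (rdotC (b v)) (rdotC (a v)).
clearbody k; have [K K0 HK] := bounded_gt0 (alg_bounded unA Ak).
apply/eqP; rewrite -subr_eq0 -kE; apply/eqP.
apply: (@eq0_of_le_sqr _ _ (K ^+ 2 * n)) => t.
have AT := A_comb t%:C (alg_id unA) Ak.
have t0 : 0 <= t ^+ 2 * K ^+ 2 by rewrite mulr_ge0 ?sqr_ge0.
(* This constant dominates [sqrt (1 + t^2 K^2)]; without the root it is polynomial in [t] and still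
   has no linear term. *)
have := @norm_le_w _ (1 + t ^+ 2 * K ^+ 2) AT.
rewrite rdotDl rdotZl.
have -> : rdot (idfun x) w = n by rewrite /w -(rdot_adjoint UU').
rewrite ltr_wpDr// => /(_ isT) H0.
suff H1 z : rdot (idfun z + t%:C *: k z) (idfun z + t%:C *: k z) <=
    (1 + t ^+ 2 * K ^+ 2) ^+ 2 * rdot z z by have := H0 H1; lra.
rewrite /= !rdotE (rdotC z (k z)) kE (rdotC (b z)) subrr.
have : rdot (k z) (k z) <= K ^+ 2 * rdot z z.
  by rewrite -!sqr_rnorm -exprMn lerXn2r ?nnegrE// mulr_ge0// ltW.
have := mulr_ge0 (mulr_ge0 t0 (addr_ge0 ler01 t0)) (rdot_ge0 z).
have := sqr_ge0 t; nra.
Qed.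

Let D z := z - U (U' z).

Let AD : A D.
Proof.
have -> : D = (fun z => idfun z + -1 *: (U \o U') z).
  by apply/funext => z; rewrite /D scaleN1r.
exact (A_comb (-1) (alg_id unA) (alg_comp unA AU AU')).
Qed.

Let D_sym : sym D.
Proof.
move=> a b; rewrite /D !rdotE (rdot_adjoint UU') [rdot a (U _)]rdotC.
by rewrite (rdot_adjoint UU') (rdotC (U' b)).
Qed.

Let D_sqr_le z : rdot (D z) (D z) <= rdot z z - rdot (U' z) (U' z).
Proof.
rewrite /D !rdotE (rdotC z (U _)) (rdot_adjoint UU' (U' z) z).
have : rdot (U (U' z)) (U (U' z)) <= rdot (U' z) (U' z).
  by rewrite -!sqr_rnorm lerXn2r ?nnegrE//; exact: CU.2.
lra.
Qed.

(* [|U' z|^2 + |D z|^2 <= |z|^2], so the row [(U, D)], the adjoint of the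
   column [(U', D)], is a contraction as well. *)
Let row_contraction u v :
  rdot (U u + D v) (U u + D v) <= rdot u u + rdot v v.
Proof.
set z := U u + D v.
have zz : rdot z z = rdot u (U' z) + rdot v (D z).
  by rewrite {1}/z rdotDl (rdot_adjoint UU') D_sym.
move: (U' z) (D z) zz (D_sqr_le z) => s e zz zse.
clearbody z; have := rdot_ge0 (u - s); have := rdot_ge0 (v - e).
by rewrite !rdotE (rdotC s u) (rdotC e v); lra.
Qed.

(** [U + t D b] is the row [(U, D)] applied to the column [(1, t b)], so its squared norm is at most
    [1 + t^2 K^2]; maximality of [U] forces the term linear in [t] to vanish. *)
Let defect_orth b : A b -> rdot (D y) (b x) = 0.
Proof.
move=> Ab; have [K K0 HK] := bounded_gt0 (alg_bounded unA Ab).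
rewrite D_sym rdotC; apply: (@eq0_of_le_sqr _ _ (K ^+ 2 * n)) => t.
have t0 : 0 <= t ^+ 2 * K ^+ 2 by rewrite mulr_ge0 ?sqr_ge0.
have := @norm_le _ (1 + t ^+ 2 * K ^+ 2)
  (A_comb t%:C AU (alg_comp unA AD Ab)).
rewrite rdotDl rdotZl ltr_wpDr// => /(_ isT) H0.
suff H1 z : rdot (U z + t%:C *: D (b z)) (U z + t%:C *: D (b z)) <=
    (1 + t ^+ 2 * K ^+ 2) ^+ 2 * rdot z z by have := H0 H1; rewrite -/n /=; lra.
rewrite -(linear_scaleE (A_lin AD)).
apply: le_trans (row_contraction _ _) _; rewrite !rdotE.
have : rdot (b z) (b z) <= K ^+ 2 * rdot z z.
  by rewrite -!sqr_rnorm -exprMn lerXn2r ?nnegrE// mulr_ge0// ltW.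
have := mulr_ge0 (mulr_ge0 t0 (addr_ge0 ler01 t0)) (rdot_ge0 z).
have := sqr_ge0 t; nra.
Qed.

(** As [E w = x - E x] and [y = D y + U w] with [E (D y) = 0], commutation with [U'] gives [(E y, y)
    = (E w, w) = n - |x|^2 + (E x, x)]. *)
Lemma effect_of_attained : exists2 E, effect A E &
  effect_gap x y E = rdot x x - n.
Proof.
have [E eE [Exw E0]] := resolvent unA adjA pos_w sym_w.
exists E => //; have linE := effect_linear unA eE.
have [symE _ comE] := eE.
have Ew : E w = x - E x.
  by rewrite -[X in X - _]Exw (linear_addE linE) addrAC subrr add0r.
have yE : y = D y + U w by rewrite /D subrK.
have EDy : E (D y) = 0 by exact: E0 defect_orth.
have Ey : rdot (E y) y = rdot (E w) w.
  rewrite [X in rdot _ X]yE rdotDr symE EDy rdot0r add0r [LHS]rdotC.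
  by rewrite (rdot_adjoint UU') -(comE _ _ AU') rdotC.
rewrite /effect_gap Ey.
rewrite Ew rdotBl (symE x w) Ew rdotBr.
have -> : rdot x w = n by rewrite /w -(rdot_adjoint UU').
by rewrite rdotC; lra.
Qed.

End NormAttaining.

(** * The functional norm *)

Section FunctionalNorm.
Variables (R : realType) (H : hilbertType R).
Implicit Types (T : H -> H) (A : set (H -> H)) (x y z : H).

Lemma opnorm_le1 T : contractions T -> opnorm T <= 1.
Proof.
move=> [linT CT]; apply: ge_sup.
  exists (rnorm (T 0)), 0 => //.
  by rewrite /= /rnorm normr0 ler01.
by move=> _ [z z1 <-]; exact: le_trans (CT z) z1.
Qed.

Lemma contraction_of_opnorm T :
  bounded_operators T -> opnorm T <= 1 -> contractions T.
Proof.
move=> bT T1; have linT := bT.1; have [K K0 HK] := bounded_gt0 bT.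
split=> // z; have [z0|z0] := eqVneq (rnorm z) 0.
  by rewrite (rnorm0_eq0 z0) linear_0E.
have {}z0 : 0 < rnorm z by rewrite lt_def z0 rnorm_ge0.
pose u := (rnorm z)^-1%:C *: z.
have u1 : rnorm u = 1.
  by rewrite rnormZ ger0_norm ?invr_ge0 ?(ltW z0)// mulVf// gt_eqF.
have : rnorm (T u) <= opnorm T.
  (* [sup] defaults to 0 on unbounded sets; boundedness of [T] is what makes [opnorm T] an upper
     bound. *)
  apply: sup_upper_bound; last by exists u => //=; rewrite u1.
  split; first by exists (rnorm (T u)), u => //=; rewrite u1.
  exists K => _ [v v1 <-]; apply: le_trans (HK v) _.
  by rewrite -[leRHS]mulr1 ler_wpM2l// ltW.
move=> /le_trans/(_ T1).
rewrite /u (linear_scaleE linT) rnormZ ger0_norm ?invr_ge0 ?(ltW z0)//.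
by rewrite mulrC ler_pdivrMr// mul1r.
Qed.

(** A crude bound, enough to see that the set in [functional_norm] is bounded above. *)
Lemma rnorm_hdot_le x y :
  rnorm (hdot x y : R[i]) <= rnorm x * (rnorm y + rnorm ('i%C *: y)).
Proof.
rewrite /rnorm normc_def /= -/(rnorm _) -/(rnorm _) -/(rnorm _) hdotE /=.
set a := rdot x y; set b := rdot x _.
apply: (@le_trans _ _ (`|a| + `|b|)).
  rewrite -[leRHS]ger0_norm ?addr_ge0// -sqrtr_sqr ler_wsqrtr//.
  rewrite -(real_normK (num_real a)) -(real_normK (num_real b)).
  have := mulr_ge0 (normr_ge0 a) (normr_ge0 b); lra.
by rewrite mulrDr lerD// rdot_CS.
Qed.

Lemma rdot_le_functional_norm A T x y : unital_operator_algebra A ->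
  A T -> contractions T ->
  rdot (T x) y <= functional_norm A (vector_functional x y).
Proof.
move=> unA AT CT; apply: (@le_trans _ _ (rnorm (hdot (T x) y : R[i]))).
  have := normc_ge_Re (hdot (T x) y).
  rewrite -[leRHS]RRe_real ?ger0_real// lecR; exact: le_trans (ler_norm _).
apply: sup_upper_bound; last first.
  by exists T => //=; split=> //; exact: opnorm_le1.
split.
  by exists (rnorm (vector_functional x y T)), T => //; split=> //; exact: opnorm_le1.
exists (rnorm x * (rnorm y + rnorm ('i%C *: y))) => _ [S [AS S1] <-].
have [_ CS] := contraction_of_opnorm (alg_bounded unA AS) S1.
apply: le_trans (rnorm_hdot_le _ _) _; rewrite ler_wpM2r// addr_ge0//.
Qed.

Lemma Lat_value A L x y : Lat A L ->
  rnorm ((idfun \- L) x) ^+ 2 + rnorm (L y) ^+ 2 =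
  rdot x x - effect_gap x y L.
Proof.
move=> [[_ adjL LL] _].
have Lsq z : rdot (L z) (L z) = rdot (L z) z.
  by rewrite (rdot_adjoint adjL) -[L (L z)]/((L \o L) z) LL rdotC.
rewrite !sqr_rnorm /effect_gap /= !rdotE !Lsq (rdotC x); ring.
Qed.

End FunctionalNorm.

Theorem theorem2p5 (R : realType) (H : hilbertType R) (A : set (H -> H))
    (hA : von_neumann_algebra A) : property_V A.
Proof.
move=> x y; have unA := vna_unital hA; have adjA := vna_adjoint hA.
have [U [AU CU Umax]] := norm_attained hA x y.
have [U' AU' UU'] := adjA _ AU.
(* [|x|^2 - effect_gap] equals [rdot (U x) y] at [E], and is no larger at the maximiser [F] and at
   the projection [L]. *)
have [E eE gapE] := effect_of_attained hA AU AU' CU UU' Umax.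
have [F eF Fmax] := effect_gap_max unA adjA x y.
have [L LL gapL] := effect_gap_projection unA adjA eF Fmax.
apply: le_trans (rdot_le_functional_norm x y unA AU CU).
apply: (@le_trans _ _ (rnorm ((idfun \- L) x) ^+ 2 + rnorm (L y) ^+ 2)).
  apply: ge_inf; last by exists L.
  by exists 0 => _ [S _ <-]; rewrite addr_ge0 ?sqr_ge0.
by rewrite (Lat_value x y LL); have := Fmax _ eE; lra.
Qed.
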